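(* Let $n\ge 1$ be an integer and let $(\mathscr{C},\mathbb{E},\mathfrak{s})$ be a pre-$n$-exangulated category. Then $\mathscr{C}$ satisfies axiom (EA2) if and only if it satisfies the following condition (EA2-1). (EA2-1): Let $$X_0\xrightarrow{f_0}X_1\xrightarrow{f_1}\cdots\xrightarrow{f_{n-1}}X_n\xrightarrow{f_n}X_{n+1}\overset{\delta}{\dashrightarrow}\quad\text{and}\quad X_0\xrightarrow{g_0}Y_1\xrightarrow{g_1}\cdots\xrightarrow{g_{n-1}}Y_n\xrightarrow{g_n}Y_{n+1}\overset{\delta'}{\dashrightarrow}$$ be distinguished $n$-exangles (with the same first term $X_0$), and let $\varphi_1\colon X_1\to Y_1$ be a morphism such that $\varphi_1f_0=g_0$. Then there exist morphisms $\varphi_i\colon X_i\to Y_i$ for $2\le i\le n+1$ such that $(\mathrm{id}_{X_0},\varphi_1,\varphi_2,\ldots,\varphi_{n+1})$ is a morphism of distinguished $n$-exangles from the first to the second (that is, $\varphi_{i+1}f_i=g_i\varphi_i$ for $1\le i\le n$, and $\delta=(\varphi_{n+1})^{*}\delta'$), and moreover the commutative diagram with top row $X_1\xrightarrow{f_1}X_2\xrightarrow{f_2}\cdots\xrightarrow{f_n}X_{n+1}$, bottom row $Y_1\xrightarrow{g_1}Y_2\xrightarrow{g_2}\cdots\xrightarrow{g_n}Y_{n+1}$ and vertical morphisms $\varphi_1,\ldots,\varphi_{n+1}$ is a homotopy cartesian diagram with differential $(f_0)_{*}\delta'\in\mathbb{E}(Y_{n+1},X_1)$.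
   Context: Fix an integer $n\ge1$. Let $\mathscr{C}$ be an additive category and $\mathbb{E}\colon\mathscr{C}^{\mathrm{op}}\times\mathscr{C}\to\mathsf{Ab}$ an additive bifunctor. An element $\delta\in\mathbb{E}(C,A)$ is called an extension. For $a\colon A\to A'$ and $c\colon C'\to C$ write $a_*\delta=\mathbb{E}(C,a)(\delta)\in\mathbb{E}(C,A')$ and $c^*\delta=\mathbb{E}(c,A)(\delta)\in\mathbb{E}(C',A)$. A morphism of extensions from $\delta\in\mathbb{E}(C,A)$ to $\delta'\in\mathbb{E}(C',A')$ is a pair $(a,c)$ with $a\colon A\to A'$, $c\colon C\to C'$ and $a_*\delta=c^*\delta'$. An extension $\delta\in\mathbb{E}(C,A)$ induces natural transformations $\delta_\sharp\colon\mathscr{C}(-,C)\Rightarrow\mathbb{E}(-,A)$, $f\mapsto f^*\delta$, and $\delta^\sharp\colon\mathscr{C}(A,-)\Rightarrow\mathbb{E}(C,-)$, $g\mapsto g_*\delta$. **Complexes.** Let $\mathbf{C}^{n+2}_{\mathscr{C}}$ be the category of complexes $X_\bullet\colon X_0\xrightarrow{d_0^X}X_1\to\cdots\to X_n\xrightarrow{d_n^X}X_{n+1}$ in $\mathscr{C}$ concentrated in degrees $0,\ldots,n+1$, with chain maps $f_\bullet=(f_0,\ldots,f_{n+1})$ as morphisms. Two complexes with the same end terms $X_0=Y_0=A$, $X_{n+1}=Y_{n+1}=C$ are homotopy equivalent if there are chain maps in both directions, which are identities in degrees $0$ and $n+1$, whose composites are chain homotopic to the identities; $[X_\bullet]$ denotes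 the resulting class. **$n$-exangles.** A pair $\langle X_\bullet,\delta\rangle$ with $X_\bullet\in\mathbf{C}^{n+2}_{\mathscr{C}}$ and $\delta\in\mathbb{E}(X_{n+1},X_0)$ is an $n$-exangle if the sequences of functors $\mathscr{C}(-,X_0)\to\cdots\to\mathscr{C}(-,X_{n+1})\xrightarrow{\delta_\sharp}\mathbb{E}(-,X_0)$ and $\mathscr{C}(X_{n+1},-)\to\cdots\to\mathscr{C}(X_0,-)\xrightarrow{\delta^\sharp}\mathbb{E}(X_{n+1},-)$ (with maps induced by the $d_i^X$) are exact. It is also written $X_0\to X_1\to\cdots\to X_{n+1}\overset{\delta}{\dashrightarrow}$. A morphism of $n$-exangles $\langle X_\bullet,\delta\rangle\to\langle Y_\bullet,\rho\rangle$ is a chain map $f_\bullet$ with $(f_0)_*\delta=(f_{n+1})^*\rho$. **Realizations.** A realization $\mathfrak{s}$ of $\mathbb{E}$ assigns to each $\delta\in\mathbb{E}(C,A)$ a homotopy equivalence class $\mathfrak{s}(\delta)=[X_\bullet]$ of complexes with $X_0=A$, $X_{n+1}=C$, such that (R0): whenever $\mathfrak{s}(\delta)=[X_\bullet]$, $\mathfrak{s}(\rho)=[Y_\bullet]$ and $(a,c)\colon\delta\to\rho$ is a morphism of extensions, there is a chain map $f_\bullet\colon X_\bullet\to Y_\bullet$ of the form $(a,f_1,\ldots,f_n,c)$, called a lift of $(a,c)$. It is exact if (R1): whenever $\mathfrak{s}(\delta)=[X_\bullet]$, $\langle X_\bullet,\delta\rangle$ is an $n$-exangle; and (R2): for every $A\in\mathscr{C}$,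 $\mathfrak{s}(0\in\mathbb{E}(0,A))=[A\xrightarrow{\mathrm{id}}A\to0\to\cdots\to0]$ and $\mathfrak{s}(0\in\mathbb{E}(A,0))=[0\to\cdots\to0\to A\xrightarrow{\mathrm{id}}A]$. If $\mathfrak{s}(\delta)=[X_\bullet]$, then $\langle X_\bullet,\delta\rangle$ is called a distinguished $n$-exangle and $X_\bullet$ a conflation. A morphism is an inflation (resp. deflation) if it equals $d_0^X$ (resp. $d_n^X$) for some conflation $X_\bullet$. **Pre-$n$-exangulated category.** A triplet $(\mathscr{C},\mathbb{E},\mathfrak{s})$ with $\mathscr{C}$ an additive category, $\mathbb{E}\colon\mathscr{C}^{\mathrm{op}}\times\mathscr{C}\to\mathsf{Ab}$ an additive bifunctor and $\mathfrak{s}$ an exact realization of $\mathbb{E}$, satisfying (EA1): inflations are closed under composition, and deflations are closed under composition. **Mapping cone.** For $f_\bullet\colon X_\bullet\to Y_\bullet$ in $\mathbf{C}^{n+2}_{\mathscr{C}}$ with $X_0=Y_0=A$ and $f_0=\mathrm{id}_A$, the mapping cone $M^f_\bullet$ is the complex $X_1\xrightarrow{d_0}X_2\oplus Y_1\xrightarrow{d_1}X_3\oplus Y_2\to\cdots\to X_{n+1}\oplus Y_n\xrightarrow{d_n}Y_{n+1}$ with $d_0=\begin{bmatrix}-d_1^X\\ f_1\end{bmatrix}$, $d_i=\begin{bmatrix}-d_{i+1}^X&0\\ f_{i+1}&d_i^Y\end{bmatrix}$ for $1\le i\le n-1$, $d_n=\begin{bmatrix}f_{n+1}&d_n^Y\end{bmatrix}$.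 **Axiom (EA2).** For all $\rho\in\mathbb{E}(D,A)$ and $c\in\mathscr{C}(C,D)$, and all distinguished $n$-exangles $\langle X_\bullet,c^*\rho\rangle$ (with $X_0=A$, $X_{n+1}=C$) and $\langle Y_\bullet,\rho\rangle$ (with $Y_0=A$, $Y_{n+1}=D$), the morphism of extensions $(\mathrm{id}_A,c)$ has a good lift $f_\bullet\colon X_\bullet\to Y_\bullet$, i.e. a lift such that $\langle M^f_\bullet,(d_0^X)_*\rho\rangle$ is a distinguished $n$-exangle. **Homotopy cartesian diagram.** A commutative diagram with top row $A_0\xrightarrow{a_0}A_1\xrightarrow{a_1}\cdots\xrightarrow{a_{n-1}}A_n$, bottom row $B_0\xrightarrow{b_0}B_1\xrightarrow{b_1}\cdots\xrightarrow{b_{n-1}}B_n$ and vertical morphisms $\psi_i\colon A_i\to B_i$ ($0\le i\le n$) in a pre-$n$-exangulated category is a homotopy cartesian diagram with differential $\partial\in\mathbb{E}(B_n,A_0)$ if $$A_0\xrightarrow{\begin{bmatrix}-a_0\\ \psi_0\end{bmatrix}}A_1\oplus B_0\xrightarrow{\begin{bmatrix}-a_1&0\\ \psi_1&b_0\end{bmatrix}}A_2\oplus B_1\to\cdots\xrightarrow{\begin{bmatrix}-a_{n-1}&0\\ \psi_{n-1}&b_{n-2}\end{bmatrix}}A_n\oplus B_{n-1}\xrightarrow{\begin{bmatrix}\psi_n&b_{n-1}\end{bmatrix}}B_n\overset{\partial}{\dashrightarrow}$$ is a distinguished $n$-exangle. *)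

(* Defs.v *)
From mathcomp Require Import all_boot ssralg.

Set Implicit Arguments.
Unset Strict Implicit.
Unset Printing Implicit Defensive.

Import GRing.Theory.
Local Open Scope ring_scope.

Declare Scope addcat_scope.
Delimit Scope addcat_scope with AC.
Local Open Scope addcat_scope.

Reserved Notation "g \oc f" (at level 40, left associativity).
Reserved Notation "A (+) B" (at level 50, left associativity).

Record additiveCategory := AdditiveCategory {
  obj :> Type;
  hom : obj -> obj -> zmodType;
  idm : forall A, hom A A;
  compm : forall A B C, hom B C -> hom A B -> hom A C;
  compA : forall A B C D (h : hom C D) (g : hom B C) (f : hom A B),
    compm h (compm g f) = compm (compm h g) f;
  comp1m : forall A B (f : hom A B), compm (idm B) f = f;
  compm1 : forall A B (f : hom A B), compm f (idm A) = f;
  compDl : forall A B C (g g' : hom B C) (f : hom A B),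
    compm (g + g') f = compm g f + compm g' f;
  compDr : forall A B C (g : hom B C) (f f' : hom A B),
    compm g (f + f') = compm g f + compm g f';
  zob : obj;
  zob_initial : forall A (f : hom zob A), f = 0;
  zob_terminal : forall A (f : hom A zob), f = 0;
  biprod : obj -> obj -> obj;
  in1 : forall A B, hom A (biprod A B);
  in2 : forall A B, hom B (biprod A B);
  pr1 : forall A B, hom (biprod A B) A;
  pr2 : forall A B, hom (biprod A B) B;
  pr1_in1 : forall A B, compm (pr1 A B) (in1 A B) = idm A;
  pr2_in2 : forall A B, compm (pr2 A B) (in2 A B) = idm B;
  pr1_in2 : forall A B, compm (pr1 A B) (in2 A B) = 0;
  pr2_in1 : forall A B, compm (pr2 A B) (in1 A B) = 0;
  biprod_id : forall A B,
    compm (in1 A B) (pr1 A B) + compm (in2 A B) (pr2 A B) = idm (biprod A B)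
}.

Arguments idm {_} A.
Arguments zob {_}.
Arguments in1 {_} A B.
Arguments in2 {_} A B.
Arguments pr1 {_} A B.
Arguments pr2 {_} A B.

Notation "g \oc f" := (compm g f) : addcat_scope.
Notation "A (+) B" := (biprod A B) : addcat_scope.

(* [ext E C A] is E(C, A): contravariant in C, covariant in A. *)
Record additiveBifunctor (K : additiveCategory) := AdditiveBifunctor {
  ext :> K -> K -> zmodType;
  ext_map : forall C C' A A' : K,
    hom C' C -> hom A A' -> {additive ext C A -> ext C' A'};
  ext_map1 : forall (C A : K) (d : ext C A), ext_map (idm C) (idm A) d = d;
  ext_mapM : forall (C C' C'' A A' A'' : K) (c : hom C' C) (c' : hom C'' C')
      (a : hom A A') (a' : hom A' A'') (d : ext C A),
    ext_map (c \oc c') (a' \oc a) d = ext_map c' a' (ext_map c a d);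
  ext_mapDl : forall (C C' A : K) (c c' : hom C' C) (d : ext C A),
    ext_map (c + c') (idm A) d
      = ext_map c (idm A) d + ext_map c' (idm A) d;
  ext_mapDr : forall (C A A' : K) (a a' : hom A A') (d : ext C A),
    ext_map (idm C) (a + a') d
      = ext_map (idm C) a d + ext_map (idm C) a' d
}.

Definition push (K : additiveCategory) (E : additiveBifunctor K)
    (C A A' : K) (a : hom A A') (d : E C A) : E C A' :=
  ext_map E (idm C) a d.

Definition pull (K : additiveCategory) (E : additiveBifunctor K)
    (C C' A : K) (c : hom C' C) (d : E C A) : E C' A :=
  ext_map E c (idm A) d.

Section Chains.
Variable K : additiveCategory.
Implicit Types A B C D P T : K.

Record link (F : K -> Type) (A : K) := Link {
  mid : K;
  arr : hom A mid;
  rest : F mid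
}.

(* [chain k A C] is the type of sequences of k.+1 composable morphisms       *)
(*   A = X_0 -> X_1 -> ... -> X_k -> X_(k+1) = C                             *)
(* with k intermediate objects.  Building the sequence by recursion makes    *)
(* both end objects part of the type, so that sequences with the same ends   *)
(* can be compared without transport along equalities of objects.  For       *)
(* X : chain k.+1 A C, X_1 is [mid X], d_0 is [arr X] and the sequence       *)
(* X_1 -> ... -> X_(k+2) is [rest X].                                        *)
Fixpoint chain (k : nat) (A C : K) : Type :=
  match k with
  | 0 => hom A C
  | k'.+1 => link (fun B => chain k' B C) A
  end.

Definition second_ob k A C : chain k A C -> K :=
  match k with
  | 0 => fun _ => C
  | k'.+1 => fun X => mid X
  end.

Definition first_arr k A C : forall X : chain k A C, hom A (second_ob X) :=
  match k with
  | 0 => fun X => X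
  | k'.+1 => fun X => arr X
  end.

Fixpoint penult_ob k A C : chain k A C -> K :=
  match k with
  | 0 => fun _ => A
  | k'.+1 => fun X => penult_ob (rest X)
  end.

Fixpoint last_arr k A C : forall X : chain k A C, hom (penult_ob X) C :=
  match k with
  | 0 => fun X => X
  | k'.+1 => fun X => last_arr (rest X)
  end.

(* [P d_i d_(i+1)] for every pair of consecutive morphisms of the sequence.  *)
Fixpoint consecutive (P : forall A B C, hom A B -> hom B C -> Prop)
    k A C : chain k A C -> Prop :=
  match k with
  | 0 => fun _ => True
  | k'.+1 => fun X =>
      P _ _ _ (arr X) (first_arr (rest X)) /\ consecutive P (rest X)
  end.

Definition is_complex k A C (X : chain k A C) : Prop :=
  consecutive (fun _ _ _ f g => g \oc f = 0) X.

(* The components X_i -> Y_i at the intermediate objects, 1 <= i <= k.       *)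
Fixpoint mids k A C B D : chain k A C -> chain k B D -> Type :=
  match k with
  | 0 => fun _ _ => unit
  | k'.+1 => fun X Y => (hom (mid X) (mid Y) * mids (rest X) (rest Y))%type
  end.

(* All the squares of (a, f_1, ..., f_k, c) : X -> Y commute.                *)
Fixpoint is_chain_map k A C B D :
    forall (X : chain k A C) (Y : chain k B D),
    hom A B -> mids X Y -> hom C D -> Prop :=
  match k with
  | 0 => fun X Y a _ c => Y \oc a = c \oc X
  | k'.+1 => fun X Y a f c =>
      arr Y \oc a = f.1 \oc arr X
      /\ @is_chain_map k' _ _ _ _ (rest X) (rest Y) f.1 f.2 c
  end.

Fixpoint mids_id k A C : forall X : chain k A C, mids X X :=
  match k with
  | 0 => fun _ => tt
  | k'.+1 => fun X => (idm (mid X), mids_id (rest X))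
  end.

Fixpoint mids_comp k A C A' C' A'' C'' :
    forall (X : chain k A C) (Y : chain k A' C') (Z : chain k A'' C''),
    mids Y Z -> mids X Y -> mids X Z :=
  match k with
  | 0 => fun _ _ _ _ _ => tt
  | k'.+1 => fun X Y Z g f => (g.1 \oc f.1, mids_comp g.2 f.2)
  end.

(* For p = 0 this is the existence of h_i : X_(i+1) -> Y_i (0 <= i <= k)     *)
(* with f_i - f'_i = d_(i-1) h_(i-1) + h_i d_i in every degree, the end      *)
(* degrees included; p stands for the term d_(i-1) h_(i-1) contributed by    *)
(* the part of the sequence that has already been traversed.                 *)
Fixpoint homotopic_rec k A C B D :
    forall (X : chain k A C) (Y : chain k B D) (p a : hom A B) (f : mids X Y)
      (c : hom C D) (a' : hom A B) (f' : mids X Y) (c' : hom C D), Prop :=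
  match k with
  | 0 => fun X Y p a _ c a' _ c' =>
      exists h : hom C B,
        a - a' = p + h \oc X /\ c - c' = Y \oc h
  | k'.+1 => fun X Y p a f c a' f' c' =>
      exists h : hom (mid X) B,
        a - a' = p + h \oc arr X
        /\ @homotopic_rec k' _ _ _ _ (rest X) (rest Y)
             (arr Y \oc h) f.1 f.2 c f'.1 f'.2 c'
  end.

Definition homotopic k A C B D (X : chain k A C) (Y : chain k B D) :=
  @homotopic_rec k A C B D X Y 0.

Definition homotopy_equivalent k A C (X Y : chain k A C) : Prop :=
  exists (f : mids X Y) (g : mids Y X),
    [/\ is_chain_map (idm A) f (idm C),
        is_chain_map (idm A) g (idm C),
        homotopic (idm A) (mids_comp g f) (idm C) (idm A) (mids_id X) (idm C)
      & homotopic (idm A) (mids_comp f g) (idm C) (idm A) (mids_id Y) (idm C)].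

(* B -> 0 -> ... -> 0 *)
Fixpoint zero_chain k B : chain k B zob :=
  match k with
  | 0 => (0 : hom B zob)
  | k'.+1 => Link (F := fun B' => chain k' B' zob) (0 : hom B zob)
               (zero_chain k' zob)
  end.

(* A -id-> A -> 0 -> ... -> 0 *)
Definition id_zeros k A : chain k.+1 A zob :=
  Link (F := fun B => chain k B zob) (idm A) (zero_chain k A).

(* B -> 0 -> ... -> 0 -> A -id-> A *)
Fixpoint zeros_id_from k B A : chain k.+1 B A :=
  match k with
  | 0 => Link (F := fun B' => chain 0 B' A) (0 : hom B A) (idm A)
  | k'.+1 => Link (F := fun B' => chain k'.+1 B' A) (0 : hom B zob)
               (zeros_id_from k' zob A)
  end.

Definition zeros_id k A : chain k.+1 zob A := zeros_id_from k zob A.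

Definition col_mor T A B (f : hom T A) (g : hom T B) : hom T (A (+) B) :=
  in1 A B \oc f + in2 A B \oc g.

Definition row_mor A B T (f : hom A T) (g : hom B T) : hom (A (+) B) T :=
  f \oc pr1 A B + g \oc pr2 A B.

(* The matrix [-a 0; u b] : A (+) B -> A' (+) B'. *)
Definition cone_mor A A' B B' (a : hom A A') (u : hom A B') (b : hom B B') :
    hom (A (+) B) (A' (+) B') :=
  row_mor (col_mor (- a) u) (col_mor 0 b).

(* A_0 (+) P -> A_1 (+) B_0 -> ... -> A_(k+1) (+) B_k -> B_(k+1), where      *)
(* p : P -> B_0.                                                             *)
Fixpoint cone_rec k A C B D P :
    forall (X : chain k A C) (Y : chain k B D) (p : hom P B)
      (u : hom A B) (f : mids X Y) (c : hom C D), chain k.+1 (A (+) P) D :=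
  match k with
  | 0 => fun X Y p u _ c =>
      Link (F := fun B' => chain 0 B' D)
        (cone_mor X u p) (row_mor c Y)
  | k'.+1 => fun X Y p u f c =>
      Link (F := fun B' => chain k'.+1 B' D)
        (cone_mor (arr X) u p)
        (@cone_rec k' _ _ _ _ _ (rest X) (rest Y) (arr Y) f.1 f.2 c)
  end.

(* A_0 -> A_1 (+) B_0 -> A_2 (+) B_1 -> ... -> A_(k+1) (+) B_k -> B_(k+1),   *)
(* for rows A_0 -> ... -> A_(k+1) and B_0 -> ... -> B_(k+1).                 *)
Definition cone k A C B D :
    forall (X : chain k A C) (Y : chain k B D)
      (u : hom A B) (f : mids X Y) (c : hom C D), chain k.+1 A D :=
  match k with
  | 0 => fun X Y u _ c =>
      Link (F := fun B' => chain 0 B' D)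
        (col_mor (- X) u) (row_mor c Y)
  | k'.+1 => fun X Y u f c =>
      Link (F := fun B' => chain k'.+1 B' D)
        (col_mor (- arr X) u)
        (cone_rec (arr Y) f.1 f.2 c)
  end.

(* The mapping cone of (id, f_1, ..., f_(k+1), c) : X -> Y does not involve  *)
(* the degree 0 part: it is the cone of X_1 -> ... over Y_1 -> ...           *)
Definition mapping_cone k A C D (X : chain k.+1 A C) (Y : chain k.+1 A D)
    (f : mids X Y) (c : hom C D) : chain k.+1 (mid X) D :=
  cone (X := rest X) (Y := rest Y) f.1 f.2 c.

End Chains.

Definition exact_at (U V W : zmodType) (f : U -> V) (g : V -> W) : Prop :=
  forall v, g v = 0 <-> exists u, f u = v.

Section Exangles.
Variables (K : additiveCategory) (E : additiveBifunctor K).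
Implicit Types A B C D T : K.

Definition is_exangle k A C (X : chain k A C) (d : E C A) : Prop :=
  [/\ is_complex X,
      consecutive (fun A B C (f : hom A B) (g : hom B C) => forall T : K,
        exact_at (fun h : hom T A => f \oc h) (fun h : hom T B => g \oc h)) X,
      forall T : K, exact_at (fun h : hom T (penult_ob X) => last_arr X \oc h)
                          (fun h : hom T C => pull h d),
      consecutive (fun A B C (f : hom A B) (g : hom B C) => forall T : K,
        exact_at (fun h : hom C T => h \oc g) (fun h : hom B T => h \oc f)) X
    & forall T : K, exact_at (fun h : hom (second_ob X) T => h \oc first_arr X)
                          (fun h : hom A T => push h d)].

Definition is_exangle_map k A C B D (X : chain k A C) (d : E C A)
    (Y : chain k B D) (r : E D B)
    (a : hom A B) (f : mids X Y) (c : hom C D) : Prop :=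
  is_chain_map a f c /\ push a d = pull c r.

(* A realization for n = m.+1 (so that n >= 1).  [realizes s d X] means      *)
(* s(d) = [X]; [realizes_class] says that the X with s(d) = [X] form exactly *)
(* one homotopy equivalence class of complexes.                              *)
Record realization (m : nat) := Realization {
  realizes :> forall A C, E C A -> chain m.+1 A C -> Prop;
  realizes_complex : forall A C (d : E C A) (X : chain m.+1 A C),
    realizes d X -> is_complex X;
  realizes_ex : forall A C (d : E C A), exists X, realizes d X;
  realizes_class : forall A C (d : E C A) (X Y : chain m.+1 A C),
    realizes d X -> is_complex Y ->
    (realizes d Y <-> homotopy_equivalent X Y);
  realizes_lift : forall A C B D (d : E C A) (r : E D B)
      (X : chain m.+1 A C) (Y : chain m.+1 B D) (a : hom A B) (c : hom C D),
    realizes d X -> realizes r Y -> push a d = pull c r ->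
    exists f : mids X Y, is_chain_map a f c
}.

Section Realization.
Variables (m : nat) (s : realization m).

Definition exact_realization : Prop :=
  [/\ forall A C (d : E C A) (X : chain m.+1 A C), s A C d X -> is_exangle X d,
      forall A, s A zob 0 (id_zeros m A)
    & forall A, s zob A 0 (zeros_id m A)].

Definition distinguished A C (X : chain m.+1 A C) (d : E C A) : Prop :=
  s A C d X.

Inductive inflation : forall A B, hom A B -> Prop :=
  Inflation A C (X : chain m.+1 A C) (d : E C A) :
    distinguished X d -> inflation (first_arr X).

Inductive deflation : forall B C, hom B C -> Prop :=
  Deflation A C (X : chain m.+1 A C) (d : E C A) :
    distinguished X d -> deflation (last_arr X).

Definition EA1 : Prop :=
  (forall A B C (f : hom A B) (g : hom B C),
     inflation f -> inflation g -> inflation (g \oc f))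
  /\ (forall A B C (f : hom A B) (g : hom B C),
     deflation f -> deflation g -> deflation (g \oc f)).

Definition pre_exangulated : Prop := exact_realization /\ EA1.

Definition EA2 : Prop :=
  forall A C D (r : E D A) (c : hom C D)
    (X : chain m.+1 A C) (Y : chain m.+1 A D),
  distinguished X (pull c r) -> distinguished Y r ->
  exists f : mids X Y,
    is_chain_map (idm A) f c
    /\ distinguished (mapping_cone f c) (push (first_arr X) r).

(* Rows A_0 -> ... -> A_n and B_0 -> ... -> B_n, n = m.+1. *)
Definition homotopy_cartesian A C B D (X : chain m A C) (Y : chain m B D)
    (u : hom A B) (f : mids X Y) (c : hom C D) (d : E D A) : Prop :=
  is_chain_map u f c /\ distinguished (cone u f c) d.

Definition EA2_1 : Prop :=
  forall X0 Xl Yl (X : chain m.+1 X0 Xl) (Y : chain m.+1 X0 Yl)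
    (d : E Xl X0) (d' : E Yl X0),
  distinguished X d -> distinguished Y d' ->
  forall u1 : hom (mid X) (mid Y), u1 \oc arr X = arr Y ->
  exists (u : mids (rest X) (rest Y)) (ul : hom Xl Yl),
    is_exangle_map (X := X) d (Y := Y) d' (idm X0) (u1, u) ul
    /\ homotopy_cartesian u1 u ul (push (arr X) d').

End Realization.
End Exangles.

(* Main.v *)
Require Import Defs.
From mathcomp Require Import all_boot ssralg.

Set Implicit Arguments.
Unset Strict Implicit.
Unset Printing Implicit Defensive.

Import Defs GRing.Theory.
Local Open Scope ring_scope.
Local Open Scope addcat_scope.

(** Both implications rest on two observations about a map [(u, f, c)] between
    the truncated rows [X_1 -> ... -> X_(n+1)] and [Y_1 -> ... -> Y_(n+1)] of
    two distinguished n-exangles with the same first term.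

    Homotopic maps have isomorphic cones: if [f - f' = d h + h d], then the
    matrices [1 0; h 1] on [X_(i+1) (+) Y_i] form an isomorphism from the cone
    of [f] to the cone of [f'] which is the identity at both ends
    ([cone_homotopic_iso]). Since a realization is closed under such
    isomorphisms, having a distinguished cone only depends on the homotopy
    class of the map ([distinguished_cone_homotopic]). Moreover a homotopy
    supported in one degree can be used to correct the first component of a
    chain map ([correct_first]) or the last one ([correct_last]).

    Assume (EA2-1), and let [(id, c)] be a morphism of extensions. Take any
    lift and apply (EA2-1) to its degree 1 component. The last component [c']
    of the result need not be [c], but [c'] and [c] pull the extension back to
    the same element, so [c' - c] factors through the last morphism of [Y]; a
    homotopy in the last degree turns [c'] into [c].

    Assume (EA2), and let [u1 d_0 = d_0]. The point is to find [c] with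
    [delta = c^* delta'] ([ext_pull_of_push0]). The extension
    [rho = (delta, delta')] in [E(C (+) D, A)] restricts to [delta'] along
    [in2], so (EA2) provides a distinguished cone whose last morphism is
    [in2, w] with [w] the last morphism of a conflation realizing [rho]. Its
    extension is [(d_0)_* rho = 0], so this last morphism has a section
    [(x, y)], and [rho = (in2 x + w y)^* rho = x^* delta'] because
    [w^* rho = 0]. A good lift of [(id, c)] agrees with [u1] after composition
    with [d_0], so it differs from [u1] by a morphism factoring through [d_1];
    a homotopy in the first degree corrects it. *)

(** * Additive categories *)

Section AdditiveCategory.
Variable K : additiveCategory.
Implicit Types A B C D P T : K.

Lemma comp0m A B C (f : hom A B) : (0 : hom B C) \oc f = 0.
Proof. by apply: (addIr ((0 : hom B C) \oc f)); rewrite -compDl !add0r. Qed.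

Lemma compm0 A B C (g : hom B C) : g \oc (0 : hom A B) = 0.
Proof. by apply: (addIr (g \oc (0 : hom A B))); rewrite -compDr !add0r. Qed.

Lemma compNm A B C (g : hom B C) (f : hom A B) : (- g) \oc f = - (g \oc f).
Proof. by apply: (addIr (g \oc f)); rewrite -compDl !addNr comp0m. Qed.

Lemma compmN A B C (g : hom B C) (f : hom A B) : g \oc (- f) = - (g \oc f).
Proof. by apply: (addIr (g \oc f)); rewrite -compDr !addNr compm0. Qed.

Lemma compBl A B C (g g' : hom B C) (f : hom A B) :
  (g - g') \oc f = g \oc f - g' \oc f.
Proof. by rewrite compDl compNm. Qed.

Lemma compBr A B C (g : hom B C) (f f' : hom A B) :
  g \oc (f - f') = g \oc f - g \oc f'.
Proof. by rewrite compDr compmN. Qed.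

Lemma comp_col T' T A B (f : hom T A) (g : hom T B) (x : hom T' T) :
  col_mor f g \oc x = col_mor (f \oc x) (g \oc x).
Proof. by rewrite /col_mor compDl !compA. Qed.

Lemma add_col T A B (f f' : hom T A) (g g' : hom T B) :
  col_mor f g + col_mor f' g' = col_mor (f + f') (g + g').
Proof. by rewrite /col_mor !compDr addrACA. Qed.

Lemma comp_row A B T T' (f : hom A T) (g : hom B T) (x : hom T T') :
  x \oc row_mor f g = row_mor (x \oc f) (x \oc g).
Proof. by rewrite /row_mor compDr !compA. Qed.

Lemma row_col T A B T' (f : hom A T') (g : hom B T') (x : hom T A)
    (y : hom T B) :
  row_mor f g \oc col_mor x y = f \oc x + g \oc y.
Proof.
rewrite /row_mor /col_mor compDl !compDr -!compA.
rewrite (compA (pr1 A B) (in1 A B)) (compA (pr1 A B) (in2 A B)).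
rewrite (compA (pr2 A B) (in1 A B)) (compA (pr2 A B) (in2 A B)).
rewrite pr1_in1 pr1_in2 pr2_in1 pr2_in2.
by rewrite !comp0m !comp1m !compm0 addr0 add0r.
Qed.

(** The matrix [1 0; h 1]. *)
Definition shear A B (h : hom A B) : hom (A (+) B) (A (+) B) :=
  row_mor (col_mor (idm A) h) (col_mor 0 (idm B)).

Definition matE := (comp_row, row_col, comp_col, add_col).

Lemma shear0 A B : shear (0 : hom A B) = idm _.
Proof.
by rewrite /shear /row_mor /col_mor !compm0 !compm1 addr0 add0r biprod_id.
Qed.

Lemma shearD A B (g h : hom A B) : shear g \oc shear h = shear (g + h).
Proof.
by rewrite /shear !matE !(compm1, comp1m, comp0m, compm0, add0r, addr0).
Qed.

Lemma shearK A B (h : hom A B) : shear (- h) \oc shear h = idm _.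
Proof. by rewrite shearD addNr shear0. Qed.

Lemma shearVK A B (h : hom A B) : shear h \oc shear (- h) = idm _.
Proof. by rewrite shearD addrN shear0. Qed.

(** The matrix form of the homotopy relation [u - u' = p h0 + h a]. *)
Lemma cone_mor_shear A A' B P (a : hom A A') (p : hom P B) (u u' : hom A B)
    (h0 : hom A P) (h : hom A' B) :
  u - u' = p \oc h0 + h \oc a ->
  cone_mor a u' p \oc shear h0 = shear h \oc cone_mor a u p.
Proof.
move=> e; rewrite /cone_mor /shear !matE.
rewrite !(compm1, comp1m, comp0m, compm0, add0r, addr0) compmN.
congr (row_mor (col_mor _ _) _).
by rewrite -[in RHS](subrK u' u) e (addrC (p \oc h0)) -addrA addKr addrC.
Qed.

Lemma row_mor_shear A B D (c c' : hom A D) (b : hom B D) (h : hom A B) :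
  c - c' = b \oc h -> row_mor c' b \oc shear h = row_mor c b.
Proof.
move=> e; rewrite /shear !matE !(compm1, compm0, add0r).
by rewrite -e addrC subrK.
Qed.

Lemma col_mor_shear A A' B (a : hom A A') (u u' : hom A B) (h : hom A' B) :
  u - u' = h \oc a ->
  shear h \oc col_mor (- a) u = col_mor (- a) u'.
Proof.
move=> e; rewrite /shear !matE !(comp1m, comp0m, addr0) compmN -e.
by rewrite opprB subrK.
Qed.

(** * Isomorphic sequences *)

(** An isomorphism that is the identity at the right end and whose component
    at the left end is [a], its inverse having [b] there; leaving the left end
    arbitrary is what makes induction along the sequence possible. *)
Definition iso_over k A B C (X : chain k A C) (Y : chain k B C)
    (a : hom A B) (b : hom B A) : Prop :=
  exists (f : mids X Y) (g : mids Y X),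
    [/\ is_chain_map a f (idm C), is_chain_map b g (idm C),
        mids_comp g f = mids_id X & mids_comp f g = mids_id Y].

Lemma iso_over_nil A B C (X : chain 0 A C) (Y : chain 0 B C)
    (a : hom A B) (b : hom B A) :
  Y \oc a = X -> X \oc b = Y -> iso_over X Y a b.
Proof. by move=> ea eb; exists tt, tt; split; rewrite //= comp1m. Qed.

Lemma iso_over_cons k A B C M N (x : hom A M) (X : chain k M C)
    (y : hom B N) (Y : chain k N C) (a : hom A B) (b : hom B A)
    (a' : hom M N) (b' : hom N M) :
  y \oc a = a' \oc x -> x \oc b = b' \oc y ->
  b' \oc a' = idm _ -> a' \oc b' = idm _ ->
  iso_over X Y a' b' ->
  iso_over (k := k.+1) (Link (F := fun T => chain k T C) x X)
    (Link (F := fun T => chain k T C) y Y) a b.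
Proof.
move=> ea eb ba ab [f [g [cf cg gf fg]]].
exists (a', f), (b', g); split=> //=.
- by rewrite ba gf.
- by rewrite ab fg.
Qed.

Lemma chain_map_first k A C B D (X : chain k A C) (Y : chain k B D) a f c :
  is_chain_map (X := X) (Y := Y) a f c ->
  exists b, first_arr Y \oc a = b \oc first_arr X.
Proof. by case: k X Y f => [|k] X Y f /= => [|[]]; [exists c | exists f.1]. Qed.

(** The components of an isomorphism are epimorphisms, so the relations
    [d d = 0] carry over from [X] to [Y]. *)
Lemma iso_over_complex k A B C (X : chain k A C) (Y : chain k B C) a b :
  a \oc b = idm B -> iso_over X Y a b -> is_complex X -> is_complex Y.
Proof.
move=> ab [f [g [cf _ _ fg]]].
elim: k A B X Y a b ab f g cf fg => [//|k IH] A B X Y a b ab f g /=.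
move=> [e cf] [fg1 fg2] [dX cX]; split.
  have [t et] := chain_map_first cf.
  rewrite -[arr Y]compm1 -ab (compA (arr Y)) e !compA et -!(compA t).
  by rewrite dX comp0m compm0.
exact: (IH _ _ _ _ _ _ fg1 f.2 g.2 cf fg2 cX).
Qed.

Lemma homotopic_rec_first k A C B D (X : chain k A C) (Y : chain k B D)
    (p a a' : hom A B) (f : mids X Y) (c : hom C D) :
  a - a' = p -> homotopic_rec p a f c a' f c.
Proof.
elim: k A B X Y p a a' f => [|k IH] A B X Y p a a' f /= e; exists 0.
  by rewrite comp0m compm0 addr0 subrr.
by rewrite comp0m addr0; split; [|apply: IH; rewrite compm0 subrr].
Qed.

Lemma iso_homotopy_equivalent k A C (X Y : chain k A C) :
  iso_over X Y (idm A) (idm A) -> homotopy_equivalent X Y.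
Proof.
move=> [f [g [cf cg gf fg]]]; exists f, g; split=> //.
- by rewrite gf; apply: homotopic_rec_first; rewrite subrr.
- by rewrite fg; apply: homotopic_rec_first; rewrite subrr.
Qed.

(** * Cones of homotopic maps *)

(** Used to invert the isomorphisms below: their inverses come from the
    opposite homotopy. *)
Lemma subr_eq_opp (V : zmodType) (x x' y : V) : x - x' = y -> x' - x = - y.
Proof. by move=> <-; rewrite opprB. Qed.

(** The isomorphism on [X_(i+1) (+) Y_i] is [shear h_i], for the components
    [h_i] of the homotopy; [p \oc h0] is the contribution of the degrees to
    the left of the part considered. *)
Lemma cone_rec_homotopic_iso k A C B D P (X : chain k A C) (Y : chain k B D)
    (p : hom P B) (h0 : hom A P) u (f : mids X Y) c u' (f' : mids X Y) c' :
  homotopic_rec (p \oc h0) u f c u' f' c' ->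
  iso_over (cone_rec p u f c) (cone_rec p u' f' c') (shear h0) (shear (- h0)).
Proof.
elim: k A B P X Y p h0 u f u' f' => [|k IH] A B P X Y p h0 u f u' f' /=.
  move=> [h [eu ec]].
  apply: (iso_over_cons (a' := shear h) (b' := shear (- h))) => /=.
  - exact: cone_mor_shear.
  - by apply: cone_mor_shear; rewrite compmN compNm -opprD; apply: subr_eq_opp.
  - exact: shearK.
  - exact: shearVK.
  apply: iso_over_nil; apply: row_mor_shear => //.
  by rewrite compmN; apply: subr_eq_opp.
move=> [h [eu hr]].
apply: (iso_over_cons (a' := shear h) (b' := shear (- h))) => /=.
- exact: cone_mor_shear.
- by apply: cone_mor_shear; rewrite compmN compNm -opprD; apply: subr_eq_opp.
- exact: shearK.
- exact: shearVK.
exact: IH.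
Qed.

Lemma cone_homotopic_iso k A C B D (X : chain k A C) (Y : chain k B D)
    u (f : mids X Y) c u' (f' : mids X Y) c' :
  homotopic u f c u' f' c' ->
  iso_over (cone u f c) (cone u' f' c') (idm A) (idm A).
Proof.
case: k X Y f f' => [|k] X Y f f'; rewrite /homotopic /=.
  move=> [h [/[!add0r] eu ec]].
  apply: (iso_over_cons (a' := shear h) (b' := shear (- h))) => /=.
  - by rewrite compm1 (col_mor_shear eu).
  - rewrite compm1 (@col_mor_shear _ _ _ _ u' u) // compNm.
    exact: subr_eq_opp.
  - exact: shearK.
  - exact: shearVK.
  apply: iso_over_nil; apply: row_mor_shear => //.
  by rewrite compmN; apply: subr_eq_opp.
move=> [h [/[!add0r] eu hr]].
apply: (iso_over_cons (a' := shear h) (b' := shear (- h))) => /=.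
- by rewrite compm1 (col_mor_shear eu).
- rewrite compm1 (@col_mor_shear _ _ _ _ u' u) // compNm.
  exact: subr_eq_opp.
- exact: shearK.
- exact: shearVK.
exact: cone_rec_homotopic_iso.
Qed.

(** * Correcting an end component by a homotopy *)

Lemma chain_map_change_first k A C B D (X : chain k A C) (Y : chain k B D)
    a a' f c :
  first_arr Y \oc a = first_arr Y \oc a' ->
  is_chain_map (X := X) (Y := Y) a f c -> is_chain_map a' f c.
Proof. by case: k X Y f => [|k] X Y f /= <-. Qed.

(** The homotopy has [h] in the first degree and zero elsewhere. When there
    are no intermediate objects it also reaches the last component, whence the
    shape of [c']. *)
Lemma correct_first k A C B D (X : chain k A C) (Y : chain k B D) u f c
    (h : hom (second_ob X) B) :
  is_complex Y -> is_chain_map (X := X) (Y := Y) u f c ->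
  exists (f' : mids X Y) (t : hom C (penult_ob Y)),
    let c' := c - last_arr Y \oc t in
    is_chain_map (u - h \oc first_arr X) f' c'
    /\ homotopic u f c (u - h \oc first_arr X) f' c'.
Proof.
case: k X Y f h => [|k] X Y f h; rewrite /homotopic /=.
  move=> _ e; exists tt, h; split; first by rewrite compBr compBl e !compA.
  by exists h; rewrite add0r !subKr.
move=> [dY cY] [e cf]; exists (f.1 - arr Y \oc h, f.2), 0 => /=.
rewrite compm0 subr0; split.
  split; first by rewrite compBr compBl e !compA.
  by apply: chain_map_change_first cf; rewrite compBr compA dY comp0m subr0.
exists h; rewrite add0r subKr; split=> //.
by apply: homotopic_rec_first; rewrite subKr.
Qed.

(** The homotopy has [h] in the last degree and zero elsewhere. The first
    component only changes when there are no intermediate objects, and then by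
    a morphism factoring through [X]; this is why [u'] still extends to the
    left by the identity when [X] and [Y] are truncations of longer rows. *)
Lemma correct_last k A C B D (X : chain k A C) (Y : chain k B D) u f c
    (h : hom C (penult_ob Y)) :
  is_complex X -> is_chain_map (X := X) (Y := Y) u f c ->
  exists (f' : mids X Y) (t : hom (second_ob X) B),
    let u' := u - t \oc first_arr X in
    is_chain_map u' f' (c - last_arr Y \oc h)
    /\ homotopic u f c u' f' (c - last_arr Y \oc h).
Proof.
elim: k A B X Y u f h => [|k IH] A B X Y u f h; rewrite /homotopic /=.
  move=> _ e; exists tt, h; split; first by rewrite compBr compBl e !compA.
  by exists h; rewrite add0r !subKr.
move=> [dX cX] [e cf].
have [f' [t [cf' hf']]] := IH _ _ _ _ _ _ h cX cf.
exists (f.1 - t \oc first_arr (rest X), f'), 0 => /=.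
rewrite comp0m subr0; split.
  by split=> //; rewrite compBl -compA dX compm0 subr0.
by exists 0; rewrite comp0m subrr addr0 compm0.
Qed.

(** * The last morphism of a cone *)

(** The penultimate object of a cone is a biproduct only up to a
    propositional equality, so the two components of a morphism into it are
    recorded as [x] and [y]. *)
Lemma last_arr_cone_rec k A C B D P (X : chain k A C) (Y : chain k B D)
    (p : hom P B) u f c :
  exists x y, last_arr (cone_rec (X := X) (Y := Y) p u f c)
              = c \oc x + last_arr Y \oc y.
Proof.
elim: k A B P X Y p u f => [|k IH] A B P X Y p u f /=; last exact: IH.
by exists (pr1 _ _), (pr2 _ _).
Qed.

Lemma last_arr_cone k A C B D (X : chain k A C) (Y : chain k B D) u f c :
  exists x y, last_arr (cone (X := X) (Y := Y) u f c)
              = c \oc x + last_arr Y \oc y.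
Proof.
case: k X Y f => [|k] X Y f /=; last exact: last_arr_cone_rec.
by exists (pr1 _ _), (pr2 _ _).
Qed.

End AdditiveCategory.

(** * Extensions *)

Section Extensions.
Variables (K : additiveCategory) (E : additiveBifunctor K).
Implicit Types A B C D T : K.

Lemma push_comp C A A' A'' (a' : hom A' A'') (a : hom A A') (d : E C A) :
  push (a' \oc a) d = push a' (push a d).
Proof. by rewrite /push -ext_mapM comp1m. Qed.

Lemma pull_comp C C' C'' A (c : hom C' C) (c' : hom C'' C') (d : E C A) :
  pull (c \oc c') d = pull c' (pull c d).
Proof. by rewrite /pull -ext_mapM comp1m. Qed.

Lemma push_pull C C' A A' (c : hom C' C) (a : hom A A') (d : E C A) :
  push a (pull c d) = pull c (push a d).
Proof. by rewrite /push /pull -!ext_mapM !comp1m !compm1. Qed.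

Lemma push1 C A (d : E C A) : push (idm A) d = d.
Proof. exact: ext_map1. Qed.

Lemma pull1 C A (d : E C A) : pull (idm C) d = d.
Proof. exact: ext_map1. Qed.

Lemma pullDl C C' A (c c' : hom C' C) (d : E C A) :
  pull (c + c') d = pull c d + pull c' d.
Proof. exact: ext_mapDl. Qed.

Lemma pull0l C C' A (d : E C A) : pull (0 : hom C' C) d = 0.
Proof. by apply: (addIr (pull (0 : hom C' C) d)); rewrite -pullDl !add0r. Qed.

Lemma pullBl C C' A (c c' : hom C' C) (d : E C A) :
  pull (c - c') d = pull c d - pull c' d.
Proof. by apply: (addIr (pull c' d)); rewrite -pullDl !subrK. Qed.

Lemma pullDr C C' A (c : hom C' C) (d d' : E C A) :
  pull c (d + d') = pull c d + pull c d'.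
Proof. exact: raddfD. Qed.

Lemma pull0r C C' A (c : hom C' C) : pull c (0 : E C A) = 0.
Proof. exact: raddf0. Qed.

Lemma pushDr C A A' (a : hom A A') (d d' : E C A) :
  push a (d + d') = push a d + push a d'.
Proof. exact: raddfD. Qed.

Lemma exangle_push_first k A C (X : chain k A C) (d : E C A) :
  is_exangle X d -> push (first_arr X) d = 0.
Proof. by case=> _ _ _ _ ex; apply/ex; exists (idm _); rewrite comp1m. Qed.

Lemma exangle_pull_last k A C (X : chain k A C) (d : E C A) :
  is_exangle X d -> pull (last_arr X) d = 0.
Proof. by case=> _ _ ex _ _; apply/ex; exists (idm _); rewrite compm1. Qed.

Section Realization.
Variables (m : nat) (s : realization E m).

Lemma distinguished_iso A C (X Y : chain m.+1 A C) (d : E C A) :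
  iso_over X Y (idm A) (idm A) -> distinguished s X d -> distinguished s Y d.
Proof.
move=> iXY sX.
have cY : is_complex Y.
  by apply: (iso_over_complex _ iXY (realizes_complex sX)); rewrite comp1m.
exact/(realizes_class sX cY)/iso_homotopy_equivalent.
Qed.

Lemma distinguished_cone_homotopic A C B D (X : chain m A C)
    (Y : chain m B D) u (f : mids X Y) c u' (f' : mids X Y) c' (d : E D A) :
  homotopic u f c u' f' c' ->
  distinguished s (cone u f c) d -> distinguished s (cone u' f' c') d.
Proof. by move/cone_homotopic_iso; apply: distinguished_iso. Qed.

Hypothesis ex_s : forall A C (d : E C A) (X : chain m.+1 A C),
  s A C d X -> is_exangle X d.

(** Exactness of [hom T D -> E T A -> E T Y_1], one term further to the right
    than what the definition of an n-exangle provides. *)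
Lemma ext_pull_of_push0 A D T (Y : chain m.+1 A D) (d' : E D A) (d : E T A) :
  EA2 s -> distinguished s Y d' -> push (arr Y) d = 0 ->
  exists c : hom T D, d = pull c d'.
Proof.
move=> ea2 sY d0.
pose r : E (T (+) D) A := pull (pr1 T D) d + pull (pr2 T D) d'.
have r1 : pull (in1 T D) r = d.
  by rewrite pullDr -!pull_comp pr1_in1 pr2_in1 pull1 pull0l addr0.
have r2 : pull (in2 T D) r = d'.
  by rewrite pullDr -!pull_comp pr1_in2 pr2_in2 pull1 pull0l add0r.
have [W sW] := realizes_ex s r.
have sY2 : distinguished s Y (pull (in2 T D) r) by rewrite r2.
have [f [_ sM]] := ea2 _ _ _ _ _ _ _ sY2 sW.
have M0 : push (first_arr Y) r = 0.
  rewrite pushDr !push_pull d0 (exangle_push_first (ex_s sY)).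
  by rewrite !pull0r addr0.
have [_ _ exM _ _] := ex_s sM.
have [|q eq] := (exM _ (idm _)).1; first by rewrite M0 pull0r.
have [x [y exy]] := last_arr_cone (X := rest Y) (Y := rest W) f.1 f.2 (in2 T D).
exists (x \oc q \oc in1 T D).
have er : r = pull (x \oc q) d'.
  rewrite -{1}[r]pull1 -eq /mapping_cone exy compDl pullDl -!compA.
  by rewrite !pull_comp r2 (exangle_pull_last (ex_s sW)) !pull0r addr0.
by rewrite pull_comp -er r1.
Qed.

(** * The equivalence *)

Lemma EA2_EA2_1 : EA2 s -> EA2_1 s.
Proof.
move=> ea2 A C D X Y d d' sX sY u1 eu1.
have [cX _ _ [exX _] _] := ex_s sX.
have [_ cY] := realizes_complex sY.
have [|c ed] := ext_pull_of_push0 (d := d) ea2 sY.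
  by rewrite -eu1 push_comp (exangle_push_first (ex_s sX)) /push raddf0.
have sX' : distinguished s X (pull c d') by rewrite -ed.
have [f [[ef cf] sM]] := ea2 _ _ _ _ _ _ _ sX' sY.
have [|h eh] := (exX _ (f.1 - u1)).1.
  by rewrite compBl eu1 -ef compm1 subrr.
have [f' [t]] := correct_first h cY cf.
rewrite eh subKr /= => -[cf' hf'].
exists f', (c - last_arr (rest Y) \oc t); split.
  split; first by rewrite /= compm1 eu1.
  rewrite push1 pullBl -ed pull_comp.
  by rewrite (exangle_pull_last (ex_s sY)) pull0r subr0.
by split=> //; apply: distinguished_cone_homotopic hf' sM.
Qed.

Lemma EA2_1_EA2 : EA2_1 s -> EA2 s.
Proof.
move=> ea21 A C D r c X Y sX sY.
have [g [eg _]] := realizes_lift sX sY (push1 _).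
rewrite compm1 in eg.
have [f [c' [[[_ _] ec'] [cf sM]]]] := ea21 _ _ _ _ _ _ _ sX sY _ (esym eg).
have [_ _ exY _ _] := ex_s sY.
have [|h eh] := (exY _ (c' - c)).1.
  by rewrite pullBl -ec' push1 subrr.
have [dX cX] := realizes_complex sX.
have [f' [t]] := correct_last (h : hom C (penult_ob (rest Y))) cX cf.
rewrite [last_arr _ \oc h]eh subKr /= => -[cf' hf'].
exists (g.1 - t \oc first_arr (rest X), f'); split.
  by split=> //=; rewrite compm1 compBl -compA dX compm0 subr0.
exact: distinguished_cone_homotopic hf' sM.
Qed.

End Realization.
End Extensions.

(* n = m.+1 *)
Theorem theorem1p1 (m : nat) (K : additiveCategory) (E : additiveBifunctor K)
    (s : realization E m) (hs : pre_exangulated s) :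
  EA2 s <-> EA2_1 s.
Proof.
have [[ex_s _ _] _] := hs.
by split; [apply: EA2_EA2_1 | apply: EA2_1_EA2].
Qed.
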